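(* Let $d\le\omega$. If $Y$ is a Tychonoff space and there are a $d$-openly generated Tychonoff space $X$ and continuous maps $r\colon X\to Y$, $e\colon Y\to X$ with $r\circ e=\mathrm{id}_Y$, then $Y$ is $d$-openly generated.
   Context: For a Tychonoff space $X$, $C(X)$ is the set of continuous $f\colon X\to\mathbb{R}$; for a set $F$, $X/F$ is the quotient of $X$ identifying $x\sim y$ iff $f(x)=f(y)$ for all $f\in C(X)\cap F$, with quotient map $q^X_F$. A family $\mathcal{C}\subseteq[S]^{<\aleph_1}$ of countable subsets of $S$ is a club if it is cofinal under inclusion and closed under unions of countable nonempty chains. $X$ is $d$-openly generated if there is a club $\mathcal{E}\subseteq[C(X)]^{<\aleph_1}$ such that $q^X_F$ is open for every $F$ that is a union of fewer than $d$ elements of $\mathcal{E}$. *)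

(* Defs.v *)
From HB Require Import structures.
From mathcomp Require Import all_boot all_order all_algebra.
From mathcomp Require Import generic_quotient.
From mathcomp Require Import boolp classical_sets functions cardinality reals.
From mathcomp Require Import topology normedtype.

Set Implicit Arguments.
Unset Strict Implicit.
Unset Printing Implicit Defensive.

Import numFieldNormedType.Exports.

Local Open Scope classical_set_scope.
Local Open Scope card_scope.
Local Open Scope quotient_scope.

Definition tychonoff_space (X : topologicalType) : Prop :=
  completely_regular_space X /\ hausdorff_space X.

Definition Cfun (R : realType) (X : topologicalType) : set (X -> R) :=
  [set f | continuous f].

Section QuotientByFunctions.
Context {R : realType} {X : topologicalType}.
Variable F : set (X -> R).

Definition sim_rel (x y : X) : bool :=
  `[< forall f, (@Cfun R X `&` F) f -> f x = f y >].

Lemma sim_rel_refl : reflexive sim_rel.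
Proof. by move=> x; apply/asboolP. Qed.

Lemma sim_rel_sym : symmetric sim_rel.
Proof. by move=> x y; apply/asboolP/asboolP => xy f /xy ->. Qed.

Lemma sim_rel_trans : transitive sim_rel.
Proof.
by move=> y x z /asboolP xy /asboolP yz; apply/asboolP => f Ff; rewrite xy ?yz.
Qed.

Definition sim : equiv_rel X :=
  EquivRel sim_rel sim_rel_refl sim_rel_sym sim_rel_trans.

Definition Cquot : topologicalType := quotient_topology {eq_quot sim}.

Definition Cquot_map : X -> Cquot := \pi_{eq_quot sim}.

End QuotientByFunctions.

Definition open_map (X Y : topologicalType) (f : X -> Y) : Prop :=
  forall U : set X, open U -> open (f @` U).

Definition countable_subsets (T : Type) (S : set T) : set (set T) :=
  [set A | A `<=` S /\ countable A].

Definition club (T : Type) (S : set T) (C : set (set T)) : Prop :=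
  [/\ C `<=` countable_subsets S,
      forall A, countable_subsets S A -> exists2 B, C B & A `<=` B &
      forall K : set (set T), K `<=` C -> countable K -> K !=set0 ->
        total_on K subset -> C (\bigcup_(A in K) A)].

(* A cardinal number is represented by an arbitrary set [d] of that cardinality,
   and "fewer than d" compares cardinalities strictly. *)
Definition card_lt (T U : Type) (A : set T) (d : set U) : Prop :=
  A #<= d /\ ~ (d #<= A).

Definition openly_generated (R : realType) (U : Type) (d : set U)
    (X : topologicalType) : Prop :=
  exists2 E : set (set (X -> R)), club (@Cfun R X) E &
    forall K : set (set (X -> R)), K `<=` E -> card_lt K d ->
      open_map (Cquot_map (\bigcup_(F in K) F)).

(* Main.v *)
(** Let [A] range over the members of the club of [X], and pull back along [e].
    If [B] is a union of members containing [f \o r] for every [f] in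
    [B' := (fun g => g \o e) @` B], then the [B']-saturation of an open set [V]
    of [Y] is the preimage under [e] of the [B]-saturation of [r @^-1` V], hence
    open.  The sets [A'] that come from such an [A] need not be closed
    under unions of chains, since the [A]'s witnessing a chain need not form a
    chain.  So one picks for each finite sequence [s] in [C(Y)] a club member
    [psi s], increasing in [s], and keeps the [A'] that are closed under the
    finitary operation [psi]: the union of [psi s] over [s] in [A'] is then
    a canonical witness for [A']. *)
Require Import Defs.
From mathcomp Require Import all_boot all_order all_algebra.
From mathcomp Require Import generic_quotient.
From mathcomp Require Import boolp classical_sets functions cardinality reals.
From mathcomp Require Import topology normedtype.

Set Implicit Arguments.
Unset Strict Implicit.
Unset Printing Implicit Defensive.

Local Open Scope classical_set_scope.
Local Open Scope card_scope.

(** * Chains and countable sets *)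

Lemma total_on_range_chain (T : Type) (F : nat -> set T) :
  (forall n, F n `<=` F n.+1) -> total_on (range F) subset.
Proof.
move=> FS; have Fle m n : m <= n -> F m `<=` F n.
  by apply: homo_leq => // [A|B A C]; [exact: subset_refl|exact: subset_trans].
move=> _ _ [m _ <-] [n _ <-].
by case/orP: (leq_total m n) => /Fle; [left|right].
Qed.

(** By induction on [s], the larger of a member holding the tail and one holding the head works;
    [K !=set0] settles the empty sequence. This is why closure under a finitary operation survives
    unions of chains. *)
Lemma seq_sub_chain (T : eqType) (K : set (set T)) (s : seq T) :
  K !=set0 -> total_on K subset -> [set` s] `<=` \bigcup_(A in K) A ->
  exists2 A, K A & [set` s] `<=` A.
Proof.
move=> K0 Ktot; elim: s => [|x s IHs] sK.
  by case: K0 => A KA; exists A => // x; rewrite /= in_nil.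
have [|A KA sA] := IHs.
  by move=> y /= ys; apply: sK; rewrite /= in_cons ys orbT.
have [|B KB Bx] := sK x; first by rewrite /= mem_head.
have [AB|BA] := Ktot A B KA KB.
  by exists B => // y; rewrite /= in_cons => /orP[/eqP->//|/sA/AB].
by exists A => // y; rewrite /= in_cons => /orP[/eqP->|/sA//]; exact: BA.
Qed.

Lemma countableU (T : Type) (A B : set T) :
  countable A -> countable B -> countable (A `|` B).
Proof.
by move=> Ac Bc; rewrite -bigcup2E; apply: bigcup_countable => // -[|[|i]].
Qed.

Lemma countable_seqs (T : eqType) (A : set T) :
  countable A -> countable [set s : seq T | [set` s] `<=` A].
Proof.
move=> /countable_injP[f finj]; apply/countable_injP.
exists (choice.pickle \o map f) => s t; rewrite !inE /= => sA tA.
move=> /(pcan_inj choice.pickleK); apply: (inj_in_map finj).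
  by apply/allP => x xs; rewrite inE; exact: sA.
by apply/allP => x xt; rewrite inE; exact: tA.
Qed.

(** * Closure under finitary operations and transfer of clubs *)

Section FinitaryClosure.
Context {T : eqType} (phi : seq T -> set T).

Definition seq_closed (A : set T) : Prop :=
  forall s, [set` s] `<=` A -> phi s `<=` A.

Lemma seq_closed_chain (K : set (set T)) :
  K `<=` seq_closed -> K !=set0 -> total_on K subset ->
  seq_closed (\bigcup_(A in K) A).
Proof.
move=> Kcl K0 Ktot s /(seq_sub_chain K0 Ktot)[A KA sA] x phix.
by exists A => //; exact: Kcl sA _ phix.
Qed.

(** Iterating [step] over the natural numbers is enough: a finite sequence in the union of the
    stages lies in some stage [F n], and its value under [phi] enters at stage [n.+1]. *)
Lemma seq_closure_countable (S A : set T) :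
  (forall s, countable (phi s)) -> (forall s, phi s `<=` S) ->
  countable_subsets S A ->
  exists2 B, countable_subsets S B /\ seq_closed B & A `<=` B.
Proof.
move=> phic phiS [AS Ac].
pose step B := B `|` \bigcup_(s in [set s | [set` s] `<=` B]) phi s.
pose F n := iter n step A.
have FS n : F n `<=` F n.+1 by move=> x Fx; left.
have FSphi n s : [set` s] `<=` F n -> phi s `<=` F n.+1.
  by move=> sF x phix; right; exists s.
have Fsub n : F n `<=` S.
  elim: n => [//|n IHn] x [|[s _]]; first exact: IHn.
  exact: phiS.
have Fc n : countable (F n).
  elim: n => [//|n IHn]; apply: countableU => //.
  by apply: bigcup_countable => //; exact: countable_seqs.
exists (\bigcup_(B in range F) B); last by move=> x Ax; exists A => //; exists 0.
split; first split.
- by move=> x [_ [n _ <-]] /Fsub.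
- apply: bigcup_countable => [|_ [n _ <-] //].
  exact/(card_le_trans (card_image_le _ _)).
- move=> s /seq_sub_chain[||_ [n _ <-] /FSphi sF].
  + by exists A; exists 0.
  + exact: total_on_range_chain.
  + by move=> x /sF Fx; exists (F n.+1) => //; exists n.+1.
Qed.

End FinitaryClosure.

(** Carries a club of $C(X)$ over to $C(Y)$, with [p] precomposition with [r] and [q] precomposition
    with [e]. *)
Lemma club_retract (T T' : eqType) (S : set T) (S' : set T') (E : set (set T))
    (p : T' -> T) (q : T -> T') :
  (forall a, S' a -> S (p a)) -> (forall a, S a -> S' (q a)) ->
  (forall a, S' a -> q (p a) = a) -> club S E ->
  exists2 E', club S' E' &
    forall A', E' A' -> exists A, [/\ E A, q @` A = A' & p @` A' `<=` A].
Proof.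
move=> pS qS qp [Ecs Ecof Echain].
have /choice[h hE] : forall A, exists B,
    countable_subsets S A -> E B /\ A `<=` B.
  move=> A; have [/Ecof[B EB AB]|nA] := pselect (countable_subsets S A).
    by exists B.
  by exists A.
(* Only points of [S'] are added, so that [psi s] lies in [E] for every [s]. *)
pose psi := foldr (fun a A => h (A `|` [set p b | b in [set a] `&` S'])) (h set0).
have csU a A : countable_subsets S A ->
    countable_subsets S (A `|` [set p b | b in [set a] `&` S']).
  move=> [AS Ac]; split.
    by move=> x [/AS//|[b [_ /pS Sb] <-]].
  apply: countableU => //; apply/(card_le_trans (card_image_le _ _)).
  apply: sub_countable (finite_set_countable (finite_set1 a)).
  by apply: subset_card_le => b [].
have psiE s : E (psi s).
  elim: s => [|a s IHs].
    by have [] := hE set0; first by split; [exact: sub0set|exact: countable0].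
  by have [] := hE _ (csU a _ (Ecs _ IHs)).
have psi_cons a s : psi s `|` [set p b | b in [set a] `&` S'] `<=` psi (a :: s).
  by have [] := hE _ (csU a _ (Ecs _ (psiE s))).
pose phi s := q @` psi s.
have phic s : countable (phi s).
  by apply/(card_le_trans (card_image_le _ _)); have [] := Ecs _ (psiE s).
have phiS s : phi s `<=` S'.
  by move=> _ [a psia <-]; apply: qS; have [+ _] := Ecs _ (psiE s); apply.
exists [set A' | countable_subsets S' A' /\ seq_closed phi A'].
  split.
  - by move=> A' [].
  - move=> A' /(seq_closure_countable phic phiS)[B Bcl AB].
    by exists B.
  - move=> K KE Kc K0 Ktot; split; last first.
      by apply: seq_closed_chain => // A' /KE[].
    split; first by move=> x [A' /KE[[A'S _] _]] /A'S.
    by apply: bigcup_countable => // A' /KE[[]].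
move=> A' [[A'S A'c] A'cl].
(* [t n] lists the first [n] terms of an enumeration of [A'], latest first, so that each step is a
   cons and [psi] grows along [t]. For empty [A'] the constant empty sequence serves. *)
have [t [t0 tS tA' A't]] : exists t : nat -> seq T',
    [/\ t 0 = [::], forall n, psi (t n) `<=` psi (t n.+1),
      forall n, [set` t n] `<=` A' &
      forall a, A' a -> exists n b, t n.+1 = b :: t n /\ b = a].
  have /pfcard_geP[A'0|[g]] := A'c.
    exists (fun=> [::]); split=> [//|n x //|n x|].
      by rewrite /= in_nil.
    by rewrite A'0.
  exists (fun n => [seq g i | i <- rev (iota 0 n)]); split=> //.
  - move=> n x xn; rewrite -addn1 iotaD rev_cat /=.
    by apply: psi_cons; left.
  - by move=> n a /= /mapP[i _ ->]; apply: funS.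
  - move=> a /(@surj _ _ _ _ g)[n _ gna]; exists n, (g n).
    by rewrite -addn1 iotaD rev_cat.
(* A countable chain in [E], so its union is in [E]. Its [q]-image stays in [A'] because [A'] is
   closed under [phi], and fills [A'] because each [p a] is added once [a] has been listed. *)
exists (\bigcup_(A in range (psi \o t)) A); split.
- apply: Echain.
  + by move=> _ [n _ <-]; exact: psiE.
  + exact/(card_le_trans (card_image_le _ _)).
  + by exists (psi (t 0)); exists 0.
  + exact: total_on_range_chain.
- apply/seteqP; split.
    move=> _ [x [_ [n _ <-] psix] <-].
    by apply: (A'cl (t n)) => //; exists x.
  move=> a A'a; have [n [b [tn ba]]] := A't a A'a.
  exists (p a); last exact/qp/A'S.
  exists (psi (t n.+1)); first by exists n.+1.
  rewrite tn ba; apply: psi_cons; right.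
  by exists a => //; split=> //; exact: A'S.
- move=> _ [a A'a <-]; have [n [b [tn ba]]] := A't a A'a.
  exists (psi (t n.+1)); first by exists n.+1.
  rewrite tn ba; apply: psi_cons; right.
  by exists a => //; split=> //; exact: A'S.
Qed.

(** * Saturations and openness of quotient maps *)

Lemma Cfun_comp (R : realType) (X Y : topologicalType) (h : X -> Y)
    (f : Y -> R) :
  continuous h -> @Cfun R Y f -> @Cfun R X (f \o h).
Proof. by move=> ch cf x; exact: (cvg_comp _ _ (ch x) (cf (h x))). Qed.

Definition saturation {R : realType} {X : topologicalType} (F : set (X -> R))
    (U : set X) : set X :=
  [set x | exists2 u, U u & sim_rel F u x].

(** A set is open in the quotient iff its preimage is, and the preimage of the image of [U] is its
    saturation. *)
Lemma open_Cquot_mapP (R : realType) (X : topologicalType) (F : set (X -> R)) :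
  open_map (Cquot_map F) <-> forall U, open U -> open (saturation F U).
Proof.
have satE U : Cquot_map F @^-1` (Cquot_map F @` U) = saturation F U.
  apply/seteqP; split=> x [u Uu].
    by move=> /eqquotP; exists u.
  by move=> ux; exists u => //; apply/eqquotP.
split=> oF U oU.
  by rewrite -satE; exact: oF.
by rewrite /open /= /quotient_open; move: (oF U oU); rewrite -satE.
Qed.

(** If [B'] does not separate [u] and [y], then [B] does not separate [e u] and [e y], as each
    [f \o e] is in [B']. If [B] does not separate [u] and [e y], testing with [g \o r] gives
    [g (r u) = g y]. *)
Lemma saturation_retract (R : realType) (X Y : topologicalType) (r : X -> Y)
    (e : Y -> X) (B : set (X -> R)) (B' : set (Y -> R)) (V : set Y) :
  continuous r -> continuous e -> cancel e r -> B `<=` @Cfun R X ->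
  [set f \o e | f in B] = B' -> [set g \o r | g in B'] `<=` B ->
  saturation B' V = e @^-1` saturation B (r @^-1` V).
Proof.
move=> cr ce er BC eB rB'.
apply/seteqP; split=> y [u Vu /asboolP uy].
  exists (e u); first by rewrite /= er.
  apply/asboolP => f [Cf Bf]; apply: (uy (f \o e)); split.
    exact: Cfun_comp.
  by rewrite -eB; exists f.
exists (r u) => //; apply/asboolP => g [Cg B'g].
have Bgr : B (g \o r) by apply: rB'; exists g.
by have := uy _ (conj (BC _ Bgr) Bgr); rewrite /= er.
Qed.

Theorem theorem4p7 (R : realType) (U : Type) (d : set U)
    (hd : d #<= [set: nat]) (Y : topologicalType) (hY : tychonoff_space Y) :
  (exists X : topologicalType,
     [/\ tychonoff_space X, openly_generated R d X &
      exists (r : X -> Y) (e : Y -> X),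
        [/\ continuous r, continuous e & r \o e = id]]) ->
  openly_generated R d Y.
Proof.
move=> [X [_ [E clubE Eopen] [r [e [cr ce re]]]]].
have er : cancel e r by move=> y; rewrite -[LHS]/((r \o e) y) re.
have [|||E' clubE' E'E] := @club_retract _ _ (@Cfun R X) (@Cfun R Y) E
    (fun g => g \o r) (fun f => f \o e) _ _ _ clubE.
- by move=> g; exact: Cfun_comp.
- by move=> f; exact: Cfun_comp.
- by move=> g _; apply/funext => y /=; rewrite er.
exists E' => // K KE' [Kd dK].
(* One witness per member of [K] gives at most as many witnesses as members, hence still fewer than
   [d]. *)
have /choice[w wE] : forall A', exists A, E' A' ->
    [/\ E A, [set f \o e | f in A] = A' & [set g \o r | g in A'] `<=` A].
  move=> A'; have [/E'E[A AP]|nE] := pselect (E' A'); first by exists A.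
  by exists set0.
have wKE : w @` K `<=` E by move=> _ [A' /KE'/wE[? _ _] <-].
have wKd : card_lt (w @` K) d.
  have wKK := card_image_le w K.
  split; first exact: card_le_trans wKK Kd.
  by move=> dwK; apply: dK; exact: card_le_trans dwK wKK.
have /open_Cquot_mapP oX := Eopen _ wKE wKd.
apply/open_Cquot_mapP => V oV.
(* Images commute with unions, so both conditions linking [w A'] to [A'] pass to the unions over
   [K]. *)
rewrite (@saturation_retract _ _ _ r e (\bigcup_(A in w @` K) A)) //.
- by move/continuousP: ce; apply; apply: oX; move/continuousP: cr; apply.
- move=> f [A /wKE EA Af]; have [+ _ _] := clubE.
  by move=> /(_ A EA)[+ _]; apply.
- apply/seteqP; split.
    move=> _ [f [_ [A' KA' <-] Af] <-]; exists A' => //.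
    by have [_ + _] := wE _ (KE' _ KA'); move=> <-; exists f.
  move=> g [A' KA' A'g]; have [_ wA' _] := wE _ (KE' _ KA').
  move: A'g; rewrite -{1}wA' => -[f wf <-]; exists f => //.
  by exists (w A') => //; exists A'.
- move=> _ [g [A' KA' A'g] <-]; have [_ _ rA'] := wE _ (KE' _ KA').
  by exists (w A'); [exists A'|apply: rA'; exists g].
Qed.
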